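(* Consider the two-point boundary value problem $-u''=-6x$ in $(0,1)$, $u(0)=u(1)=0$, whose exact solution is $u(x)=x^3-x$. For an integer $n\ge 3$ let $h=\frac1n$ and consider the grid $x_i=\frac{ih}{2}+\frac{i^2h^2}{2}$, $0\le i\le n$, of $[0,1]$. Let $V_h$ be the space of continuous functions on $[0,1]$ that are affine on each $[x_{i-1},x_i]$ and vanish at $0$ and $1$. Let $u_h^\star\in V_h$ be the solution of the linear finite element method in which every element integral is replaced by the left-endpoint rectangle rule. Then there is a constant $C$ independent of $h$ such that $$\|u-u_h^\star\|_{L^2(0,1)}\ \ge\ \frac1{50}\,h-Ch^2 .$$ In particular, the optimal order $O(h^2)$ of the $L^2$-error is not attained with this quadrature rule.
   Context: The left-endpoint rectangle rule on $[x_{i-1},x_i]$ is $\int_{x_{i-1}}^{x_i}\varphi\,dx\approx (x_i-x_{i-1})\,\varphi(x_{i-1})$, where $\varphi(x_{i-1})$ means the value (one-sided limit) taken from inside $[x_{i-1},x_i]$; it has algebraic precision $0$. Thus $u_h^\star\in V_h$ is defined by $$\sum_{i=1}^n (x_i-x_{i-1})\,[(u_h^\star)'v_h'](x_{i-1}^+)=\sum_{i=1}^n (x_i-x_{i-1})\,(-6x_{i-1})\,v_h(x_{i-1})\qquad\forall v_h\in V_h .$$ *)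

(* Defs.v *)
From HB Require Import structures.
From mathcomp Require Export all_boot all_order all_algebra.
From mathcomp Require Export all_classical all_reals all_analysis.
Export Order.TTheory GRing.Theory Num.Theory.
Export numFieldNormedType.Exports.

Set Implicit Arguments.
Unset Strict Implicit.
Unset Printing Implicit Defensive.

Local Open Scope classical_set_scope.
Local Open Scope ring_scope.

(* Functions on [0, 1] are represented by total functions [R -> R]; only their
   values on [0, 1] are ever constrained, so uniqueness is equality there. *)

Definition source (R : realType) (x : R) : R := - (6 * x).

Definition solves_bvp (R : realType) (u : R -> R) : Prop :=
  [/\ {within `[0, 1]%classic, continuous u},
      forall x : R, 0 < x < 1 ->
        [/\ derivable u x 1, derivable (derive1 u) x 1
          & - derive1 (derive1 u) x = source x],
      u 0 = 0 & u 1 = 0].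

Definition exact_solution (R : realType) (x : R) : R := x ^+ 3 - x.

Definition mesh (R : realType) (n : nat) : R := n%:R^-1.

Definition node (R : realType) (n i : nat) : R :=
  i%:R * mesh R n / 2 + i%:R ^+ 2 * mesh R n ^+ 2 / 2.

Definition affine_on (R : realType) (a b : R) (v : R -> R) : Prop :=
  exists c d : R, forall x : R, a <= x <= b -> v x = c * x + d.

Definition fe_space (R : realType) (n : nat) : set (R -> R) :=
  [set v : R -> R | [/\ {within `[0, 1]%classic, continuous v},
               forall i, (1 <= i <= n)%N ->
                 affine_on (node R n i.-1) (node R n i) v,
               v 0 = 0 & v 1 = 0]].

(* [phi (a^+)], the limit of [phi] at [a] from the right. *)
Definition right_value (R : realType) (phi : R -> R) (a : R) : R :=
  lim (phi y @[y --> a^'+]).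

Definition left_rect_fem_solution (R : realType) (n : nat) (w : R -> R) : Prop :=
  fe_space n w /\
  forall v, fe_space n v ->
    \sum_(1 <= i < n.+1) (node R n i - node R n i.-1) *
        right_value (fun y => derive1 w y * derive1 v y) (node R n i.-1) =
    \sum_(1 <= i < n.+1) (node R n i - node R n i.-1) *
        source (node R n i.-1) * v (node R n i.-1).

(* The norm of [L^2(0, 1)], as an extended real: [restrict] extends [g] by zero
   outside the interval. *)
Definition L2norm01 (R : realType) (g : R -> R) : \bar R :=
  Lnorm (@lebesgue_measure R) 2%:E (EFin \o (g \_ `]0, 1[%classic)).

(* Main.v *)
From mathcomp Require Import ring lra measurable_realfun.
Require Import Defs.
Set Implicit Arguments.
Unset Strict Implicit.
Unset Printing Implicit Defensive.
Local Open Scope classical_set_scope.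
Local Open Scope ring_scope.

(** Write [e] for the error [u - w] of the quadrature finite element solution
    [w], and [x_i], [d_i = x_(i+1) - x_i], [h] for the nodes, the steps and the
    mesh size. The lower bound is a duality argument. By Hoelder's inequality the
    [L^2] norm of [e] on [(0, 1)] is at least its mean value. As [w] is piecewise
    affine, its mean value is its trapezoid sum, which summation by parts turns
    into the energy product of [w] with the nodal interpolant of
    [z x = x * (1 - x) / 2], the solution of [- z'' = 1] ([trapezoid_green]). The
    left rectangle rule is exact on that product, so the scheme itself, tested
    with the interpolant of [z], evaluates it. Hence ([integral_error_dual_load])
    the mean of [e] is exactly
    [\sum_i d_i * G x_i - 1 / 4] with [G x = 6 * x * z x = 3 * x ^+ 2 * (1 - x)],
    that is, the error of the left rectangle rule for [G], whose integral is
    [1 / 4].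

    On a uniform grid this error would be of second order, because [G] vanishes
    at both ends. Here consecutive steps differ by exactly [h ^+ 2], so that after
    summation by parts the left rectangle sum exceeds the trapezoid sum by
    [h ^+ 2 / 2 * \sum_i G x_i], a positive quantity of order [h]: with
    [s_i = i * h] one has [G x_i >= 3 / 4 * s_i ^+ 2 * (1 - s_i)], which makes it
    at least [h / 32] up to higher order ([left_rule_excess]). The trapezoid rule
    itself is off by [O (h ^+ 2)]. This gives the bound with [C = 4], and
    the failure of second order follows by letting [n] grow.

    Existence comes from an explicit discrete flux: Abel summation shows that the
    scheme asks that the slope jump by [6 * x_i * d_i] at [x_i], and the constant
    that remains is fixed by the right boundary value. Uniqueness follows by
    testing the scheme with the difference of two solutions. For the continuous
    problem, the difference with [x ^+ 3 - x] has vanishing second derivative, so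
    it is affine by the mean value theorem, and it vanishes at both ends. *)

Section LeftRectangleFEM.
Context {R : realType}.
Implicit Types (n i k : nat) (v w : R -> R).
Notation mu := (@lebesgue_measure R).

(** * The boundary value problem *)

Lemma exact_solution_continuous (A : set R) :
  {within A, continuous (@exact_solution R)}.
Proof.
apply: continuous_subspaceT => x.
apply: cvgB; last exact: cvg_id.
exact: exprn_continuous.
Qed.

Lemma is_derive_exact (x : R) : is_derive x 1 (@exact_solution R) (3 * x ^+ 2 - 1).
Proof.
rewrite /exact_solution; apply: is_derive_eq; rewrite /GRing.scale /=; ring.
Qed.

Lemma is_derive_exact2 (x : R) :
  is_derive x 1 (fun x : R => 3 * x ^+ 2 - 1 : R) (6 * x).
Proof. apply: is_derive_eq; rewrite /GRing.scale /=; ring. Qed.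

(** The forward direction applies the mean value theorem three times to the
    difference [d] with the exact solution: once to see that its derivative is
    constant on [`]0, 1[], and on both sides of [x] to compare [d x] with the two
    boundary values. *)
Lemma solves_bvpP (u : R -> R) :
  solves_bvp u <-> (forall x : R, 0 <= x <= 1 -> u x = exact_solution x).
Proof.
have near01 (x : R) : 0 < x < 1 -> \forall y \near x, 0 < y < 1.
  move=> x01; have : \forall y \near x, y \in `]0, 1[.
    by apply: near_in_itvoo; rewrite in_itv.
  by apply: filterS => y; rewrite in_itv.
have dE (x : R) : derive1 (@exact_solution R) x = 3 * x ^+ 2 - 1.
  by rewrite derive1E; have := is_derive_exact x => ?; rewrite derive_val.
split=> [[cu du u0 u1]|uE].
- pose d x := u x - exact_solution x.
  have cd a b : 0 <= a -> b <= 1 -> {within `[a, b], continuous d}.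
    move=> a0 b1; have ab01 : `[a, b] `<=` `[0, 1].
      move=> y /=; rewrite !in_itv /= => /andP[ay yb].
      by rewrite (le_trans a0 ay) (le_trans yb b1).
    apply: (continuous_subspaceW ab01) => x.
    by apply: cvgB; [exact: cu|exact: exact_solution_continuous].
  pose d' x := derive1 u x - (3 * x ^+ 2 - 1).
  have dd (x : R) : 0 < x < 1 -> is_derive x 1 d (d' x).
    move=> /du[dux _ _]; apply: is_deriveB.
      by apply: DeriveDef; rewrite ?derive1E.
    exact: is_derive_exact.
  have dd' (x : R) : 0 < x < 1 -> is_derive x 1 d' 0.
    move=> /du[_ ddux ux].
    have -> : 0 = derive1 (derive1 u) x - 6 * x.
      by move: ux; rewrite /source => /eqP; rewrite eqr_opp => /eqP ->; rewrite subrr.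
    apply: is_deriveB; last exact: is_derive_exact2.
    by apply: DeriveDef; rewrite ?[RHS]derive1E.
  have cst (x y : R) : 0 < x -> x < y -> y < 1 -> d' x = d' y.
    move=> x0 xy y1.
    have [||c _] := @MVT R d' (fun=> 0) x y xy.
    - move=> z; rewrite in_itv /= => /andP[xz zy].
      by apply: dd'; rewrite (lt_trans x0 xz) (lt_trans zy y1).
    - apply: derivable_within_continuous => z; rewrite in_itv /= => /andP[xz zy].
      have z01 : 0 < z < 1 by rewrite (lt_le_trans x0 xz) (le_lt_trans zy y1).
      by have := dd' z z01 => ?; exact: ex_derive.
    by rewrite mul0r => /eqP; rewrite subr_eq0 => /eqP.
  have d0 : d 0 = 0 by rewrite /d u0 /exact_solution; ring.
  have d1 : d 1 = 0 by rewrite /d u1 /exact_solution; ring.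
  move=> x /andP[]; rewrite le_eqVlt => /predU1P[<- _|x0].
    by apply/eqP; rewrite -subr_eq0 -/(d 0) d0.
  rewrite le_eqVlt => /predU1P[->|x1].
    by apply/eqP; rewrite -subr_eq0 -/(d 1) d1.
  have [||a] := @MVT R d d' 0 x x0.
  + move=> z; rewrite in_itv /= => /andP[z0 zx].
    by apply: dd; rewrite z0 (lt_trans zx x1).
  + exact/cd/ltW.
  rewrite in_itv /= d0 !subr0 => /andP[a0 ax] dx.
  have [||b] := @MVT R d d' x 1 x1.
  + move=> z; rewrite in_itv /= => /andP[xz z1].
    by apply: dd; rewrite z1 (lt_trans x0 xz).
  + exact/cd/lexx/ltW.
  rewrite in_itv /= d1 sub0r => /andP[xb b1] dx1.
  rewrite -(cst a b a0 (lt_trans ax xb) b1) in dx1.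
  have d'a : d' a = 0 by move: dx dx1 => ->; lra.
  by apply/eqP; rewrite -subr_eq0 -/(d x) dx d'a mul0r.
- have uux (x : R) : 0 < x < 1 -> \forall y \near x, exact_solution y = u y.
    move=> /near01; apply: filterS => y /andP[y0 y1].
    by rewrite uE // !ltW.
  have u'E (x : R) : 0 < x < 1 -> derive1 u x = 3 * x ^+ 2 - 1.
    by move=> /uux x01; rewrite -dE !derive1E (near_eq_derive _ x01).
  split.
  + apply: (@subspace_eq_continuous _ _ _ (@exact_solution R)).
      by move=> x; rewrite inE /= in_itv /= => /uE.
    exact: exact_solution_continuous.
  + move=> x x01.
    have ed := is_derive_exact x; have ed2 := is_derive_exact2 x.
    have u'x : \forall y \near x, (3 * y ^+ 2 - 1 : R) = derive1 u y.
      by have := near01 x x01; apply: filterS => y /u'E.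
    split.
    * exact: near_eq_derivable (uux x x01) ex_derive.
    * exact: near_eq_derivable u'x ex_derive.
    * by rewrite derive1E -(near_eq_derive _ u'x) derive_val /source.
  + by rewrite uE ?lexx ?ler01 // /exact_solution; ring.
  + by rewrite uE ?lexx ?ler01 // /exact_solution; ring.
Qed.

(** * The graded grid *)

Definition step n i : R := node R n i.+1 - node R n i.

Lemma mesh_gt0 n : (0 < n)%N -> 0 < mesh R n.
Proof. by move=> n0; rewrite /mesh invr_gt0 ltr0n. Qed.

Lemma mulr_mesh n : (0 < n)%N -> n%:R * mesh R n = 1.
Proof. by move=> n0; rewrite /mesh mulfV // pnatr_eq0 -lt0n. Qed.

Lemma ler_mesh n k : (0 < n)%N -> (k <= n)%N -> k%:R * mesh R n <= 1.
Proof.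
move=> n0 kn; rewrite -[leRHS](mulr_mesh n0).
by rewrite ler_wpM2r ?ler_nat // ltW ?mesh_gt0.
Qed.

Lemma node0 n : node R n 0 = 0.
Proof. by rewrite /node !mul0r expr0n /= !mul0r addr0. Qed.

Lemma node_last n : (0 < n)%N -> node R n n = 1.
Proof. by move=> n0; rewrite /node -exprMn mulr_mesh // expr1n; lra. Qed.

(** In particular two consecutive steps differ by [mesh R n ^+ 2]; this
    grading is the source of the first-order error. *)
Lemma stepE n i : step n i = mesh R n / 2 + (2 * i%:R + 1) * mesh R n ^+ 2 / 2.
Proof. by rewrite /step /node -natr1; ring. Qed.

Lemma step_gt0 n i : (0 < n)%N -> 0 < step n i.
Proof.
move=> n0; have h0 := mesh_gt0 n0; rewrite stepE.
have i0 : 0 <= i%:R :> R by [].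
apply: ltr_pwDl; first by rewrite divr_gt0.
by rewrite divr_ge0 // mulr_ge0 ?exprn_ge0 ?(ltW h0) //; lra.
Qed.

Lemma node_lt n i : (0 < n)%N -> node R n i < node R n i.+1.
Proof. by move=> n0; rewrite -subr_gt0 step_gt0. Qed.

Lemma node_le n i k : (0 < n)%N -> (i <= k)%N -> node R n i <= node R n k.
Proof.
move=> n0; elim: k => [|k IH]; first by rewrite leqn0 => /eqP->.
rewrite leq_eqVlt => /predU1P[->//|/IH /le_trans]; apply.
exact/ltW/node_lt.
Qed.

Lemma node_ge0 n i : (0 < n)%N -> 0 <= node R n i.
Proof. by move=> n0; rewrite -(node0 n) node_le. Qed.

Lemma node_le1 n i : (0 < n)%N -> (i <= n)%N -> node R n i <= 1.
Proof. by move=> n0 le; rewrite -(node_last n0) node_le. Qed.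

Lemma node_cover n k (x : R) : (0 < k)%N -> 0 <= x <= node R n k ->
  exists2 i, (i < k)%N & node R n i <= x <= node R n i.+1.
Proof.
elim: k => // -[_ _ x01|k IH _ /andP[x0 xk]].
  by exists 0%N; rewrite // node0.
have [xlt|xge] := leP x (node R n k.+1); last first.
  by exists k.+1; rewrite // (ltW xge).
by have [||i ik xi] := IH; rewrite ?x0 //; exists i; rewrite // ltnW.
Qed.

(** * Piecewise affine functions and the scheme in terms of slopes *)

Definition slope n v i : R := (v (node R n i.+1) - v (node R n i)) / step n i.

Lemma step_slope n v i : (0 < n)%N ->
  step n i * slope n v i = v (node R n i.+1) - v (node R n i).
Proof. by move=> n0; rewrite mulrC /slope divfK // gt_eqF ?step_gt0. Qed.

Lemma fe_spaceE n v i x : (0 < n)%N -> fe_space n v -> (i < n)%N ->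
  node R n i <= x <= node R n i.+1 ->
  v x = v (node R n i) + slope n v i * (x - node R n i).
Proof.
move=> n0 [_ + _ _] lein; move=> /(_ i.+1 lein) [c [d vE]] xi.
have xx := node_lt i n0.
have -> : slope n v i = c.
  rewrite /slope !vE ?lexx ?(ltW xx) //= /step.
  by field; rewrite subr_eq0 gt_eqF.
by rewrite !vE ?lexx ?(ltW xx) //; ring.
Qed.

Lemma fe_spaceB n v w : fe_space n v -> fe_space n w ->
  fe_space n (fun x => v x - w x).
Proof.
move=> [cv av v0 v1] [cw aw w0 w1]; split.
- by move=> x; apply: cvgB; [exact: cv|exact: cw].
- move=> i i1; have [c [d vE]] := av _ i1; have [c' [d' wE]] := aw _ i1.
  by exists (c - c'), (d - d') => x xi; rewrite vE // wE //; ring.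
- by rewrite v0 w0 subrr.
- by rewrite v1 w1 subrr.
Qed.

Lemma derive1_affine v (a b c d x : R) : a < x < b ->
  (forall y, a <= y <= b -> v y = c + d * (y - a)) -> derive1 v x = d.
Proof.
move=> xab vE; rewrite derive1E.
rewrite (@near_eq_derive _ _ _ _ (fun y => c + d * (y - a))); last first.
  have : \forall y \near x, y \in `]a, b[ by apply: near_in_itvoo; rewrite in_itv.
  apply: filterS => y; rewrite in_itv /= => /andP[ay yb]; apply: vE.
  by rewrite !ltW.
have -> : (fun y : R => c + d * (y - a)) = (fun y : R => (c - d * a) + d *: y).
  by apply/funext => y; rewrite /GRing.scale /=; ring.
by rewrite derive_val add0r mul1r /GRing.scale /= mulr1.
Qed.

(** Derivatives are locally constant inside an element, so the one-sided limit
    is the limit of an eventually constant function. *)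
Lemma right_value_slopes n v w i : (0 < n)%N -> fe_space n v -> fe_space n w ->
  (i < n)%N ->
  right_value (fun y => derive1 w y * derive1 v y) (node R n i) =
  slope n w i * slope n v i.
Proof.
move=> n0 vV wV lein; apply: lim_near_cst; first exact: norm_hausdorff.
near=> y.
have xy : node R n i < y < node R n i.+1.
  apply/andP; split; near: y; first exact: nbhs_right_gt.
  exact/nbhs_right_lt/node_lt.
rewrite (derive1_affine xy (fun y => @fe_spaceE n w i y n0 wV lein)).
by rewrite (derive1_affine xy (fun y => @fe_spaceE n v i y n0 vV lein)).
Unshelve. all: by end_near. Qed.

(** The derivatives are constant on each element, so the quadrature rule is exact
    on the left-hand side of the scheme; only the load is perturbed. *)
Lemma left_rect_fem_solutionP n w : (0 < n)%N ->
  left_rect_fem_solution n w <-> fe_space n w /\ forall v, fe_space n v ->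
    \sum_(i < n) slope n w i * (v (node R n i.+1) - v (node R n i)) =
    \sum_(i < n) step n i * source (node R n i) * v (node R n i).
Proof.
move=> n0; split=> -[wV eqw]; split=> // v vV.
- have := eqw _ vV; rewrite !big_add1 /= !big_mkord => <-.
  apply: eq_bigr => i _; rewrite right_value_slopes // -/(step n i).
  by rewrite -(step_slope v i n0); ring.
- rewrite !big_add1 /= !big_mkord; rewrite -(eqw _ vV).
  apply: eq_bigr => i _; rewrite right_value_slopes // -/(step n i).
  by rewrite -(step_slope v i n0); ring.
Qed.

(** * Construction of piecewise affine functions *)

(** The continuous function with slope [1] on the [i]-th element and [0]
    elsewhere, written with [min] and [max] so that continuity is immediate. *)
Definition ramp n i x : R :=
  Num.min (Num.max x (node R n i)) (node R n i.+1) - node R n i.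

Definition broken_line n (p : nat -> R) x : R := \sum_(i < n) p i * ramp n i x.

Lemma ramp_left n i x : (0 < n)%N -> x <= node R n i -> ramp n i x = 0.
Proof.
by move=> n0 xi; rewrite /ramp max_r // min_l ?subrr // ltW ?node_lt.
Qed.

Lemma ramp_right n i x : (0 < n)%N -> node R n i.+1 <= x ->
  ramp n i x = step n i.
Proof.
move=> n0 ix; rewrite /ramp max_l ?min_r //.
exact: le_trans (ltW (node_lt _ n0)) ix.
Qed.

Lemma ramp_in n i x : node R n i <= x <= node R n i.+1 ->
  ramp n i x = x - node R n i.
Proof. by move=> /andP[ix xi]; rewrite /ramp max_l // min_l. Qed.

Lemma broken_lineE n p k x : (0 < n)%N -> (k < n)%N ->
  node R n k <= x <= node R n k.+1 ->
  broken_line n p x = \sum_(i < k) p i * step n i + p k * (x - node R n k).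
Proof.
move=> n0 kn /andP[kx xk]; rewrite /broken_line.
rewrite -(big_mkord xpredT (fun i => p i * ramp n i x)).
rewrite (@big_cat_nat _ _ _ k.+1) //= (@big_nat_recr _ _ _ k) //=.
rewrite ramp_in ?kx // [X in _ + X]big1_seq ?addr0 => [|i]; last first.
  rewrite mem_index_iota => /andP[_ /andP[ki _]]; rewrite ramp_left ?mulr0 //.
  exact: le_trans xk (node_le n0 ki).
congr (_ + _); rewrite big_mkord; apply: eq_bigr => i _.
rewrite ramp_right //; exact: le_trans (node_le n0 (ltn_ord i)) kx.
Qed.

Lemma broken_line_node n p k : (0 < n)%N -> (k <= n)%N ->
  broken_line n p (node R n k) = \sum_(i < k) p i * step n i.
Proof.
move=> n0; case: k => [_|k kn].
  rewrite big_ord0 /broken_line big1 // => i _.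
  by rewrite ramp_left ?mulr0 // node_le.
rewrite (@broken_lineE n p k) // ?lexx ?node_le //.
by rewrite big_ord_recr.
Qed.

Lemma broken_line_fe n (p : nat -> R) : (0 < n)%N -> \sum_(i < n) p i * step n i = 0 ->
  fe_space n (broken_line n p).
Proof.
move=> n0 p0; split.
- apply: continuous_subspaceT => x.
  apply: cvg_big => [|i _]; first exact: add_continuous.
  apply: cvgM; first exact: cvg_cst.
  apply: cvgB; last exact: cvg_cst.
  apply: (@continuous_min _ _ (fun y => Num.max y (node R n i)) (cst _)).
    by apply: (@continuous_max _ _ id (cst _)); [exact: cvg_id|exact: cvg_cst].
  exact: cvg_cst.
- case=> // i; rewrite /= => lein.
  exists (p i), (\sum_(j < i) p j * step n j - p i * node R n i) => x xi.
  by rewrite (broken_lineE p n0 lein xi); ring.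
- by rewrite -[X in broken_line _ _ X](node0 n) broken_line_node // big_ord0.
- by rewrite -[X in broken_line _ _ X](node_last n0) broken_line_node // p0.
Qed.

Lemma fe_interpolant n (c : nat -> R) : (0 < n)%N -> c 0%N = 0 -> c n = 0 ->
  exists2 v, fe_space n v & forall k, (k <= n)%N -> v (node R n k) = c k.
Proof.
move=> n0 c0 cn; pose p i := (c i.+1 - c i) / step n i.
have pc k : \sum_(i < k) p i * step n i = c k.
  under eq_bigr do rewrite /p divfK ?gt_eqF ?step_gt0 //.
  by rewrite -(big_mkord xpredT (fun i => c i.+1 - c i)) telescope_sumr // c0 subr0.
exists (broken_line n p); first by apply: broken_line_fe; rewrite ?pc.
by move=> k kn; rewrite broken_line_node // pc.
Qed.

(** * Existence and uniqueness of the discrete solution *)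

Lemma fe_space_eq n v w : (0 < n)%N -> fe_space n v -> fe_space n w ->
  (forall i, (i < n)%N -> slope n v i = slope n w i) ->
  forall x, 0 <= x <= 1 -> v x = w x.
Proof.
move=> n0 vV wV vw.
have vwn k : (k <= n)%N -> v (node R n k) = w (node R n k).
  elim: k => [|k IH] kn; first by case: vV wV => _ _ + _ [_ _ + _]; rewrite node0 => -> ->.
  apply/eqP; rewrite -(inj_eq (addIr (- v (node R n k)))) {2}IH 1?ltnW //.
  by rewrite -!step_slope // vw.
move=> x; rewrite -(node_last n0) => /(node_cover n0)[i lein xi].
by rewrite (fe_spaceE n0 vV lein xi) (fe_spaceE n0 wV lein xi) vw // vwn // ltnW.
Qed.

(** Tested with the difference of two solutions, the scheme makes the weighted
    sum of squares of the slope differences vanish. *)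
Lemma fem_unique n w w' : (0 < n)%N -> left_rect_fem_solution n w ->
  left_rect_fem_solution n w' -> forall x, 0 <= x <= 1 -> w' x = w x.
Proof.
move=> n0 /(left_rect_fem_solutionP _ n0)[wV eqw].
move=> /(left_rect_fem_solutionP _ n0)[w'V eqw'].
apply: (fe_space_eq n0 w'V wV) => i lein.
have dV := fe_spaceB w'V wV.
have := eqw' _ dV; rewrite -(eqw _ dV) => /eqP.
rewrite -subr_eq0 -sumrB.
pose q j := step n j * (slope n w' j - slope n w j) ^+ 2.
rewrite (eq_bigr (fun j : 'I_n => q j)) => [|j _]; last first.
  have jump : w' (node R n j.+1) - w (node R n j.+1) -
      (w' (node R n j) - w (node R n j)) =
      step n j * (slope n w' j - slope n w j).
    by rewrite mulrBr !step_slope //; ring.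
  by rewrite jump /q; ring.
rewrite psumr_eq0 => [|j _]; last by rewrite mulr_ge0 ?sqr_ge0 ?ltW ?step_gt0.
move=> /allP /(_ (Ordinal lein)); rewrite mem_index_enum => /(_ isT) /=.
by rewrite mulf_eq0 gt_eqF ?step_gt0 //= sqrf_eq0 subr_eq0 => /eqP.
Qed.

Lemma sum_step n k : \sum_(i < k) step n i = node R n k.
Proof.
rewrite -(big_mkord xpredT (step n)) telescope_sumr //.
by rewrite node0 subr0.
Qed.

(** The slopes are the sums of the discrete loads [6 * x_j * d_j] up to a constant
    [alpha], which the right boundary condition determines; Abel summation
    then gives the scheme. *)
Lemma fem_exists n : (0 < n)%N -> exists w, left_rect_fem_solution n w.
Proof.
move=> n0; pose q k := \sum_(j < k) 6 * node R n j * step n j.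
pose alpha := - \sum_(i < n) q i.+1 * step n i.
pose p i := alpha + q i.+1.
have p0 : \sum_(i < n) p i * step n i = 0.
  under eq_bigr do rewrite mulrDl.
  by rewrite big_split /= -mulr_sumr sum_step node_last // mulr1 addNr.
have wV := broken_line_fe n0 p0.
exists (broken_line n p); apply/left_rect_fem_solutionP => //; split=> // v vV.
have slopeE i : (i < n)%N -> slope n (broken_line n p) i = p i.
  move=> lein; rewrite /slope !broken_line_node ?(ltnW lein) //.
  by rewrite big_ord_recr /= [X in X - _]addrC addrK mulfK // gt_eqF ?step_gt0.
under eq_bigr => i _ do rewrite slopeE //.
case: vV => _ _ v0 v1.
suff abel k : \sum_(i < k) p i * (v (node R n i.+1) - v (node R n i)) =
    (alpha + q k) * v (node R n k) +
    \sum_(i < k) step n i * source (node R n i) * v (node R n i).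
  by rewrite abel node_last // v1 mulr0 add0r.
elim: k => [|k IH]; first by rewrite !big_ord0 node0 v0 mulr0 addr0.
rewrite !big_ord_recr /= {}IH /p /q big_ord_recr /= /source; ring.
Qed.

(** * Integrals over [[0, 1]] *)

(** Hoelder's inequality against the indicator of [`]0, 1[], which has norm [1]. *)
Lemma Rintegral_le_L2norm01 (g : R -> R) : {within `[0, 1], continuous g} ->
  ((\int[mu]_(x in `[0, 1]) g x)%:E <= L2norm01 g)%E.
Proof.
move=> cg.
have ig : mu.-integrable `[0, 1] (EFin \o g).
  by apply: continuous_compact_integrable => //; exact: segment_compact.
pose D : set R := `]0, 1[%classic.
have mD : measurable D by exact: measurable_itv.
have D01 : D `<=` `[0, 1] by exact: subset_itvW.
have iD : mu.-integrable D (EFin \o g) by exact: integrableS ig.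
have mg : measurable_fun D g by have /measurable_int /measurable_EFinP := iD.
have mg0 : measurable_fun [set: R] (g \_ D) by exact: (measurable_restrictT g mD).1 mg.
have m1 : measurable_fun [set: R] (\1_D : R -> R) by exact: measurable_indic.
have p2 : (0 < 2 :> R)%R by [].
have pq : (2^-1 + 2^-1 = 1 :> R)%R by lra.
have := @hoelder _ _ _ mu _ _ _ _ mg0 m1 p2 p2 pq.
have -> : Lnorm mu 2%:E (EFin \o (\1_D : R -> R)) = 1%E.
  rewrite unlock /Lnorm.
  have -> : (fun x => `|(EFin \o (\1_D : R -> R)) x| `^ 2)%E = (fun x => (\1_D x)%:E).
    apply/funext => x; rewrite /= indicE.
    by case: (x \in D); rewrite ?normr1 ?normr0 ?powR1 ?powR0.
  have -> : (\int[mu]_x (\1_D x)%:E = mu D)%E.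
    by rewrite -[in RHS](setIT D) -integral_indic.
  rewrite lebesgue_measure_itv /= lte_fin ltr01.
  by rewrite oppr0 adde0 poweR_EFin powR1.
rewrite mule1 -/(L2norm01 g); apply: le_trans.
have -> : \int[mu]_(x in `[0, 1]) g x = \int[mu]_(x in D) g x.
  rewrite -Rintegral_itv_bndo_bndc ?Rintegral_itv_obnd_cbnd //.
  apply: integrableS ig => // y /=.
  by rewrite !in_itv /= => /andP[-> /ltW ->].
have -> : (Lnorm mu 1 (EFin \o ((g \_ D) \* \1_D)%R) =
           \int[mu]_(x in D) `|(g x)%:E|)%E.
  rewrite Lnorm1 [RHS]integral_mkcond; congr integral; apply/funext => x /=.
  by rewrite !patchE indicE; case: (x \in D); rewrite ?mulr1 ?mulr0 ?normr0.
rewrite /Rintegral fineK; last exact: integrable_fin_num.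
apply: le_trans (lee_abs _) _.
by apply: le_abse_integral => //; exact/measurable_EFinP.
Qed.

Lemma integral_exact_sub_affine (c s a b : R) : a < b ->
  \int[mu]_(x in `[a, b]) (exact_solution x - (c + s * (x - a))) =
  b ^+ 4 / 4 - b ^+ 2 / 2 - (a ^+ 4 / 4 - a ^+ 2 / 2) -
  (b - a) * (c + (c + s * (b - a))) / 2.
Proof.
move=> ab.
pose F (x : R) : R := x ^+ 4 / 4 - x ^+ 2 / 2 - (c * x + s * (x - a) ^+ 2 / 2).
have dF (x : R) : is_derive x 1 F (exact_solution x - (c + s * (x - a))).
  by apply: is_derive_eq; rewrite /exact_solution /GRing.scale /=; field.
have cF : continuous F.
  by move=> x; apply/differentiable_continuous/derivable1_diffP; apply: ex_derive.
rewrite /Rintegral (@continuous_FTC2 _ _ F) //.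
- by rewrite /F /=; field.
- apply: continuous_subspaceT => x; apply: cvgB.
    by apply: cvgB; [exact: exprn_continuous|exact: cvg_id].
  apply: cvgD; first exact: cvg_cst.
  apply: cvgM; first exact: cvg_cst.
  by apply: cvgB; [exact: cvg_id|exact: cvg_cst].
- split=> [x _||]; first exact: ex_derive.
  + exact/cvg_at_right_filter/cF.
  + exact/cvg_at_left_filter/cF.
- by move=> x _; rewrite derive1E derive_val.
Qed.

Lemma fem_error_continuous n (w : R -> R) : fe_space n w ->
  {within `[0, 1], continuous (fun x => exact_solution x - w x)}.
Proof.
case=> cw _ _ _ x; apply: cvgB; last exact: cw.
exact: exact_solution_continuous.
Qed.

(** The trapezoid rule is exact for the piecewise affine part, and the integral of
    the exact solution is [- 1 / 4]. *)
Lemma integral_error n (w : R -> R) : (0 < n)%N -> fe_space n w ->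
  \int[mu]_(x in `[0, 1]) (exact_solution x - w x) =
  - 4^-1 - \sum_(i < n) step n i * (w (node R n i) + w (node R n i.+1)) / 2.
Proof.
move=> n0 wV; pose e x := exact_solution x - w x.
have ie : mu.-integrable `[0, 1] (EFin \o e).
  apply: continuous_compact_integrable; first exact: segment_compact.
  exact: fem_error_continuous wV.
suff H k : (k <= n)%N -> \int[mu]_(x in `[0, node R n k]) e x =
    node R n k ^+ 4 / 4 - node R n k ^+ 2 / 2 -
    \sum_(i < k) step n i * (w (node R n i) + w (node R n i.+1)) / 2.
  have := H _ (leqnn n); rewrite node_last // => ->.
  by congr (_ - _); field.
elim: k => [_|k IH kn].
  by rewrite node0 set_itv1 Rintegral_set1 big_ord0; ring.
have xk : node R n k < node R n k.+1 by exact: node_lt.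
have x0 : 0 <= node R n k by exact: node_ge0.
have x1 : node R n k.+1 <= 1 by exact: node_le1.
have ik : mu.-integrable `[0, node R n k.+1] (EFin \o e).
  apply: integrableS ie => // y /=.
  by rewrite !in_itv /= => /andP[-> yk]; rewrite (le_trans yk x1).
have := @Rintegral_itvB R e (BLeft 0) (BRight (node R n k.+1)) (node R n k) ik.
rewrite !bnd_simp => /(_ x0 (ltW xk)) /eqP.
rewrite subr_eq IH ?(ltnW kn) // => /eqP ->.
rewrite Rintegral_itv_obnd_cbnd; last first.
  apply: integrableS ik => // y /=.
  by rewrite !in_itv /= => /andP[/ltW /(le_trans x0) -> ->].
under eq_Rintegral => x.
  rewrite inE /= in_itv /= => xi.
  rewrite /e (fe_spaceE n0 wV kn xi).
  over.
rewrite integral_exact_sub_affine // -/(step n k) (mulrC (slope _ _ _)) step_slope //.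
by rewrite big_ord_recr /=; field.
Qed.

(** * The mean value of the error by duality *)

(** The solution of [- z'' = 1] with zero boundary values. *)
Definition dual_solution x : R := x * (1 - x) / 2.

(** Discrete Green formula: the two sides differ elementwise by the increment of
    [(x - 1 / 2) * w x], which vanishes at both ends of the interval. *)
Lemma trapezoid_green n (w : R -> R) : (0 < n)%N -> fe_space n w ->
  \sum_(i < n) step n i * (w (node R n i) + w (node R n i.+1)) / 2 =
  \sum_(i < n) slope n w i *
    (dual_solution (node R n i.+1) - dual_solution (node R n i)).
Proof.
move=> n0 [_ _ w0 w1]; apply/eqP; rewrite -subr_eq0 -sumrB.
(* [x - 1 / 2] is the opposite of the derivative of [dual_solution]. *)
pose F i := (node R n i - 2^-1) * w (node R n i).
rewrite (eq_bigr (fun i : 'I_n => F i.+1 - F i)) => [|i _]; last first.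
  rewrite /F /slope /dual_solution /step; field.
  by rewrite subr_eq0 gt_eqF ?node_lt.
rewrite -(big_mkord xpredT (fun i => F i.+1 - F i)) telescope_sumr //.
by rewrite /F node0 node_last // w0 w1 !mulr0 subrr.
Qed.

(** The opposite of [source x * dual_solution x]. *)
Definition dual_load x : R := 3 * x ^+ 2 * (1 - x).

(** The interpolant of [dual_solution] is an admissible test function, and the
    scheme evaluates its energy product with [w]. *)
Lemma integral_error_dual_load n (w : R -> R) : (0 < n)%N ->
  left_rect_fem_solution n w ->
  \int[mu]_(x in `[0, 1]) (exact_solution x - w x) =
  \sum_(i < n) step n i * dual_load (node R n i) - 4^-1.
Proof.
move=> n0 /(left_rect_fem_solutionP _ n0)[wV eqw].
rewrite (integral_error n0 wV) trapezoid_green //.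
have [|| v vV vE] := @fe_interpolant n (fun i => dual_solution (node R n i)) n0.
- by rewrite node0 /dual_solution; ring.
- by rewrite node_last // /dual_solution; ring.
have -> : \sum_(i < n) slope n w i *
      (dual_solution (node R n i.+1) - dual_solution (node R n i)) =
    - \sum_(i < n) step n i * dual_load (node R n i).
  transitivity (\sum_(i < n) slope n w i * (v (node R n i.+1) - v (node R n i))).
    by apply: eq_bigr => i _; rewrite !vE // ltnW.
  rewrite eqw // -sumrN; apply: eq_bigr => i _.
  by rewrite vE ?(ltnW (ltn_ord i)) // /source /dual_solution /dual_load; field.
ring.
Qed.

Lemma step_le n i : (0 < n)%N -> (i < n)%N -> step n i <= 3 / 2 * mesh R n.
Proof.
move=> n0 lein; have h0 : 0 < mesh R n by exact: mesh_gt0.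
have : i.+1%:R * mesh R n <= 1 by exact: ler_mesh.
rewrite -natr1 stepE => H.
have : 0 <= mesh R n * (1 - (i%:R + 1) * mesh R n).
  by rewrite mulr_ge0 ?subr_ge0 // ltW.
have h2 : 0 <= mesh R n ^+ 2 by rewrite sqr_ge0.
rewrite !expr2 in h2 *; nra.
Qed.

Definition dual_load_primitive x : R := x ^+ 3 - 3 / 4 * x ^+ 4.

(** Left rule = trapezoid rule minus half of [d_i * (G x_(i+1) - G x_i)]. As
    [d_(i+1) = d_i + h ^+ 2], that product is the increment of [d_i * G x_i]
    minus [h ^+ 2 * G x_(i+1)]. The trapezoid rule for [G] loses at most
    [d_i ^+ 3], and [G x_(i+1)] is bounded below through
    [s / 2 <= x_(i+1) <= s], where [s] is [i.+1] times the mesh size. *)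
Lemma dual_load_step n i : (0 < n)%N -> (i < n)%N ->
  dual_load_primitive (node R n i.+1) - dual_load_primitive (node R n i)
   - (step n i.+1 * dual_load (node R n i.+1)
      - step n i * dual_load (node R n i)) / 2
   + 3 / 8 * mesh R n ^+ 2 *
       ((i.+1%:R * mesh R n) ^+ 2 * (1 - i.+1%:R * mesh R n))
   - 27 / 8 * mesh R n ^+ 3
  <= step n i * dual_load (node R n i).
Proof.
move=> n0 lein; set h := mesh R n; set s := i.+1%:R * h.
set x := node R n i; set y := node R n i.+1.
have h0 : 0 < h by exact: mesh_gt0.
have s0 : 0 <= s by rewrite mulr_ge0 // ltW.
have s1 : s <= 1 by exact: ler_mesh.
have x0 : 0 <= x by exact: node_ge0.
have xy : x < y by exact: node_lt.
have y1 : y <= 1 by exact: node_le1.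
have d0 : 0 < step n i :> R by exact: step_gt0.
have dh : step n i <= 3 / 2 * h by exact: step_le.
have -> : step n i.+1 = step n i + h ^+ 2 by rewrite !stepE -/h -natr1; field.
have yE : y = (s + s ^+ 2) / 2 by rewrite /y /node /s -/h; field.
have lower : 3 / 4 * (s ^+ 2 * (1 - s)) <= dual_load y.
  have sy : s / 2 <= y by rewrite yE; have := sqr_ge0 s; lra.
  have ys : y <= s.
    have : 0 <= s * (1 - s) by rewrite mulr_ge0 ?subr_ge0.
    by rewrite yE; lra.
  have -> : 3 / 4 * (s ^+ 2 * (1 - s)) = 3 * (s / 2) ^+ 2 * (1 - s) by field.
  apply: ler_pM; rewrite ?mulr_ge0 ?sqr_ge0 ?subr_ge0 ?(ltW h0) //; last by lra.
  by rewrite ler_pM2l // lerXn2r ?nnegrE ?divr_ge0 // (le_trans x0 (ltW xy)).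
have cube : step n i ^+ 3 <= 27 / 8 * h ^+ 3.
  have -> : 27 / 8 * h ^+ 3 = (3 / 2 * h) ^+ 3 by field.
  by rewrite lerXn2r ?nnegrE ?(ltW d0) ?mulr_ge0 ?divr_ge0 ?(ltW h0).
(* The error of the trapezoid rule on a cubic is computed exactly. *)
have trap : dual_load_primitive y - dual_load_primitive x - step n i ^+ 3
    <= step n i * (dual_load x + dual_load y) / 2.
  have -> : step n i = y - x by [].
  rewrite -subr_ge0.
  have -> : (y - x) * (dual_load x + dual_load y) / 2 -
     (dual_load_primitive y - dual_load_primitive x - (y - x) ^+ 3) =
     (y - x) ^+ 3 * (3 / 4 * (2 - x - y)).
    by rewrite /dual_load /dual_load_primitive; field.
  by rewrite mulr_ge0 ?exprn_ge0 ?subr_ge0 ?(ltW xy) //; lra.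
have hl : 3 / 8 * h ^+ 2 * (s ^+ 2 * (1 - s)) <= h ^+ 2 * dual_load y / 2.
  by have := ler_wpM2l (sqr_ge0 h) lower; lra.
move: trap cube hl; lra.
Qed.

(** The one-element bounds add up: the increments telescope, and the grading
    terms are sums of powers of integers, known in closed form. *)
Lemma left_rule_excess n : (0 < n)%N ->
  mesh R n / 50 - 4 * mesh R n ^+ 2 <=
  \sum_(i < n) step n i * dual_load (node R n i) - 4^-1.
Proof.
move=> n0; set h := mesh R n.
have h0 : 0 < h by exact: mesh_gt0.
have nh : n%:R * h = 1 by exact: mulr_mesh.
(* The bracket is the sum of [s_j ^+ 2 * (1 - s_j)] for [1 <= j <= k]. *)
have partial k : (k <= n)%N ->
    dual_load_primitive (node R n k) - step n k * dual_load (node R n k) / 2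
    + 3 / 8 * h ^+ 2 * (h ^+ 2 * (k%:R * (k%:R + 1) * (2 * k%:R + 1)) / 6 -
         h ^+ 3 * (k%:R * (k%:R + 1)) ^+ 2 / 4)
    - 27 / 8 * h ^+ 3 * k%:R
    <= \sum_(i < k) step n i * dual_load (node R n i).
  elim: k => [_|k IH kn].
    rewrite big_ord0 node0 /dual_load /dual_load_primitive le_eqVlt.
    by apply/orP; left; apply/eqP; ring.
  rewrite big_ord_recr /=.
  apply: le_trans (lerD (IH (ltnW kn)) (dual_load_step n0 kn)).
  by rewrite le_eqVlt; apply/orP; left; apply/eqP; rewrite -/h -natr1; field.
have := partial n (leqnn n).
rewrite node_last //.
have -> : dual_load 1 = 0 by rewrite /dual_load subrr mulr0.
have -> : dual_load_primitive 1 = 4^-1 by rewrite /dual_load_primitive; field.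
have -> : 3 / 8 * h ^+ 2 * (h ^+ 2 * (n%:R * (n%:R + 1) * (2 * n%:R + 1)) / 6 -
         h ^+ 3 * (n%:R * (n%:R + 1)) ^+ 2 / 4) =
   h / 32 * (n%:R * h) * (n%:R * h + h) *
     (4 * (n%:R * h) + 2 * h - 3 * (n%:R * h) * (n%:R * h + h)).
  by field.
have -> : 27 / 8 * h ^+ 3 * n%:R = 27 / 8 * h ^+ 2 * (n%:R * h) by ring.
rewrite nh => H.
have h1 : h <= 1 by rewrite -nh ler_peMl ?(ltW h0) // ler1n.
have h3 : h ^+ 3 <= h ^+ 2 by rewrite exprS ler_piMl ?sqr_ge0.
apply: le_trans (lerB H (lexx _)).
have h2 : 0 <= h ^+ 2 by exact: sqr_ge0.
have -> : h / 32 * 1 * (1 + h) * (4 * 1 + 2 * h - 3 * 1 * (1 + h)) =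
  (h - h ^+ 3) / 32 by field.
lra.
Qed.

Lemma fem_error_lower n (w : R -> R) : (0 < n)%N -> left_rect_fem_solution n w ->
  ((1 / 50 * mesh R n - 4 * mesh R n ^+ 2)%:E <=
   L2norm01 (fun x => exact_solution x - w x)%R)%E.
Proof.
move=> n0 sol.
apply: le_trans (Rintegral_le_L2norm01 (fem_error_continuous sol.1)).
rewrite lee_fin (integral_error_dual_load n0 sol).
by apply: le_trans (left_rule_excess n0); lra.
Qed.

(** The lower bound and an upper bound [C * h ^+ 2] would give
    [1 <= 50 * (4 + C) * h] for all small [h]. *)
Lemma not_second_order : ~ (exists C : R, \forall n \near \oo,
   forall w : R -> R, left_rect_fem_solution n w ->
     (L2norm01 (fun x => exact_solution x - w x)%R <= (C * mesh R n ^+ 2)%:E)%E).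
Proof.
case=> C [N _ HN].
pose n := maxn N (Num.trunc (50 * (4 + C))).+1.
have n0 : (0 < n)%N by rewrite leq_max orbT.
have nC : 50 * (4 + C) < n%:R.
  apply: lt_le_trans (truncnS_gt _) _; rewrite ler_nat; exact: leq_maxr.
have [w sol] := fem_exists n0.
have := le_trans (fem_error_lower n0 sol) (HN n (leq_maxl _ _) w sol).
rewrite lee_fin => le.
have h0 : 0 < mesh R n by exact: mesh_gt0.
have nh : n%:R * mesh R n = 1 by exact: mulr_mesh.
have : 50 * (4 + C) * mesh R n < 1 by rewrite -[ltRHS]nh ltr_pM2r.
have : mesh R n <= mesh R n * (50 * (4 + C) * mesh R n).
  by move: le; rewrite expr2; lra.
by rewrite -{1}[mesh R n]mulr1 ler_pM2l //; lra.
Qed.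

End LeftRectangleFEM.

Theorem mainTheorem4 (R : realType) :
  [/\ (forall u : R -> R,
         solves_bvp u <-> (forall x : R, 0 <= x <= 1 -> u x = exact_solution x)),
      (forall n : nat, (3 <= n)%N ->
         exists2 w : R -> R, left_rect_fem_solution n w &
           forall w' : R -> R, left_rect_fem_solution n w' ->
             forall x : R, 0 <= x <= 1 -> w' x = w x),
      (exists C : R, forall n : nat, (3 <= n)%N ->
         forall w : R -> R, left_rect_fem_solution n w ->
           ((1 / 50 * mesh R n - C * mesh R n ^+ 2)%:E
              <= L2norm01 (fun x => exact_solution x - w x)%R)%E)
    & ~ (exists C : R, \forall n \near \oo,
         forall w : R -> R, left_rect_fem_solution n w ->
           (L2norm01 (fun x => exact_solution x - w x)%R
              <= (C * mesh R n ^+ 2)%:E)%E)].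
Proof.
split.
- exact: solves_bvpP.
- move=> n n3; have n0 : (0 < n)%N by apply: leq_trans n3.
  have [w sol] := @fem_exists R n n0.
  by exists w => // w'; exact: fem_unique.
- exists 4 => n n3 w; apply: fem_error_lower; exact: leq_trans n3.
- exact: not_second_order.
Qed.
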